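(* Consider the six families (A), (B.a.i), (B.a.ii), (B.b.i), (B.b.ii), (B.b.iii) of coefficients of explicit $3$-stage stochastic Runge--Kutta methods of order $(2,2)$ given in the context, and the deterministic order three conditions $$\text{(D1)}\quad \alpha^T(A^{(0)}e)^2=\tfrac13,\qquad\qquad \text{(D2)}\quad \alpha^T(A^{(0)}(A^{(0)}e))=\tfrac16 .$$ 1. In the families (A), (B.a.i) and (B.b.ii), the conditions (D1), (D2) cannot be fulfilled. 2. In the family (B.a.ii), one obtains from (D1) and (D2) a method of order $(3,2)$ if $$c_7=\frac12c_6\pm\frac16\sqrt{9c_6^2-36c_6+24}-\frac1{3c_6},\qquad c_8=\frac1{3c_6}.$$ 3. For the families (B.b.i) and (B.b.iii), the condition $\alpha^TA^{(0)}e=\frac12$ together with (D1) leads to the following three possibilities: a) $\alpha_2=\frac34$, $A^{(0)}_{21}=\frac23$, $A^{(0)}_{31}=-A^{(0)}_{32}$; b) $\alpha_3=\frac34-\alpha_2$, $A^{(0)}_{21}=\frac23$, $A^{(0)}_{31}=\frac23-A^{(0)}_{32}$; c) $\alpha_2=\frac16\frac{2-3(A^{(0)}_{31}+A^{(0)}_{32})}{A^{(0)}_{21}(A^{(0)}_{21}-A^{(0)}_{31}-A^{(0)}_{32})}$, $\alpha_3=\frac16\frac{3A^{(0)}_{21}-2}{(A^{(0)}_{31}+A^{(0)}_{32})(A^{(0)}_{21}-A^{(0)}_{31}-A^{(0)}_{32})}$, if $A^{(0)}_{31}+A^{(0)}_{32}\neq A^{(0)}_{21}\neq0$ and $A^{(0)}_{31}+A^{(0)}_{32}\ne0$.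 4. In the family (B.b.i), (D1) and (D2) are fulfilled: in case a) if $c_6=\frac34$, $c_7=\frac1{4c_9}$, $c_8=\frac23$, with $c_7\notin\{-\frac34,0,\frac12\}\cup\,]-\frac14,0[$; in case b) if $c_6=\frac34-\frac1{4c_9}$, $c_7=\frac1{4c_9}$, $c_8=\frac23$, with $c_9\ne0$ and $c_6\in\,]0,\frac14[\,\cup\,]\frac14,\frac34[$; in case c) if $$c_6=\frac16\,\frac{2-3\lambda}{c_8(c_8-\lambda)},\qquad c_7=\frac16\,\frac{3c_8-2}{\lambda(c_8-\lambda)},\qquad c_9=\frac{\lambda(c_8-\lambda)}{(3c_8-2)c_8}$$ for $\lambda\in\mathbb{R}$ with $\lambda\notin\{0,\frac23,c_8,\frac23-c_8\}$, $(\lambda-1)c_8\ne\lambda^2-\frac23$, $c_8\notin\{0,\frac23\}$, and with: $\lambda<\frac23$ if $c_8=1$; $\frac{3c_8-2}{3(c_8-1)}\le\lambda<\frac23$ if $\frac23<c_8<1$; $\frac23<\lambda$ or $\lambda\le\frac{3c_8-2}{3(c_8-1)}$ if $0<c_8<\frac23$; $\lambda<\frac23$ or $\lambda\ge\frac{3c_8-2}{3(c_8-1)}$ if $c_8<0$ or $c_8>1$. (The relation $\lambda=\frac{1-2c_6c_8}{2c_7}$ is then automatically fulfilled.) 5. The family (B.b.iii) fulfills (D1) and (D2) in case a) for $c_6=\frac34$ and $c_7=\frac23$, as well as in case c) with $c_6=\frac1{4c_7-\frac43}$ if $c_7\notin\{-\frac16,0,\frac13\}$. For case b) there exists no solution.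
   Context: Here $e=(1,1,1)^T$, squares of column vectors are component-wise, and $\alpha=(\alpha_1,\alpha_2,\alpha_3)^T\in\mathbb{R}^3$, $A^{(0)},B^{(0)}\in\mathbb{R}^{3\times3}$ (strictly lower triangular) are the coefficients of the drift part of an explicit 3-stage stochastic Runge--Kutta method; $c_1\in\{-1,1\}$. A method is of order $(p_D,p_S)$ if it has order $p_D$ when applied to deterministic ordinary differential equations and weak order $p_S$ when applied to It\^o stochastic differential equations. A method of order $(2,2)$ which also satisfies (D1) and (D2) is of order $(3,2)$. The families of order $(2,2)$ methods are as follows (the remaining coefficients of the methods do not enter (D1), (D2); only the nonzero or free strictly lower triangular entries are listed, and all other entries are zero): (A): $\alpha^T=(\frac12,\frac12,0)$, $A^{(0)}_{21}=1$, $A^{(0)}_{31}=A^{(0)}_{32}=0$, $B^{(0)}_{21}=c_1$. (B.a.i): $c_6,c_7\in\mathbb{R}$; $\alpha^T=(\frac12-c_6,c_6,\frac12)$, $A^{(0)}_{21}=0$, $A^{(0)}_{31}=c_7$, $A^{(0)}_{32}=1-c_7$, $B^{(0)}_{31}=c_1$. (B.a.ii): $c_6,c_7,c_8\in\mathbb{R}$, $c_6\ne0$; $\alpha^T=\left(\frac12-\frac{1-c_7-c_8}{2c_6},\frac{1-c_7-c_8}{2c_6},\frac12\right)$, $A^{(0)}_{21}=c_6$, $A^{(0)}_{31}=c_7$, $A^{(0)}_{32}=c_8$, $B^{(0)}_{31}=c_1$. (B.b.i): $c_6,c_7,c_8,c_9\in\mathbb{R}$ with $c_6\neq0$, $c_7\ne0$,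 $c_6\neq-c_7$, $\kappa:=c_6c_7(2c_6+2c_7-1)\ge0$ and $c_6\ne\pm\sqrt\kappa$ (both values excluded); with $\lambda:=\frac{1-2c_6c_8}{2c_7}$: $\alpha^T=(1-c_6-c_7,c_6,c_7)$, $A^{(0)}_{21}=c_8$, $A^{(0)}_{31}=\lambda-c_9$, $A^{(0)}_{32}=c_9$, $B^{(0)}_{21}=\frac{c_1}2\frac{c_6\mp\sqrt\kappa}{c_6(c_6+c_7)}$, $B^{(0)}_{31}=\frac{c_1}2\frac{c_7\pm\sqrt\kappa}{c_7(c_6+c_7)}$ (either choice of sign, upper or lower throughout). (B.b.ii): $c_6,c_7,c_8\in\mathbb{R}$, $c_8\ne0$; $\alpha^T=(\frac12,0,\frac12)$, $A^{(0)}_{21}=c_6$, $A^{(0)}_{31}=1-c_7$, $A^{(0)}_{32}=c_7$, $B^{(0)}_{21}=c_8$, $B^{(0)}_{31}=c_1$. (B.b.iii): $c_6,c_7,c_8\in\mathbb{R}$, $c_6\notin\{-\frac12,0\}$; $\alpha^T=(1,c_6,-c_6)$, $A^{(0)}_{21}=c_7$, $A^{(0)}_{31}=\frac{1-2c_6c_7}{-2c_6}-c_8$, $A^{(0)}_{32}=c_8$, $B^{(0)}_{21}=\frac{c_1}2(1+\frac1{2c_6})$, $B^{(0)}_{31}=\frac{c_1}2(1-\frac1{2c_6})$.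
   Formalization: In 3, A^(0)_21≠0 is assumed (if A^(0)_21=0, α_3=3/4, A^(0)_31+A^(0)_32=2/3, none of a)-c) holds); in 5, (D1), (D2) are claimed for a suitable c_8, as (D2) fixes it; in 5 the case c) label is claimed only for c_7≠2/3, since A^(0)_31+A^(0)_32=0 there. *)

(* Defs.v *)
From mathcomp Require Import all_boot all_order all_algebra.
From mathcomp Require Import reals.

Set Implicit Arguments.
Unset Strict Implicit.
Unset Printing Implicit Defensive.

Import Order.TTheory GRing.Theory Num.Theory.
Local Open Scope ring_scope.

(* Stage indices, numbered from 1 as in Butcher tableaux. *)
Definition st1 : 'I_3 := @Ordinal 3 0 isT.
Definition st2 : 'I_3 := @Ordinal 3 1 isT.
Definition st3 : 'I_3 := @Ordinal 3 2 isT.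

(* The coefficients alpha, A^(0), B^(0) of the drift part of a 3-stage
   stochastic Runge-Kutta method. *)
Record driftCoef (R : realType) := DriftCoef {
  alpha : 'cV[R]_3;
  A0 : 'M[R]_3;
  B0 : 'M[R]_3
}.

Section Coefficients.
Variable R : realType.
Implicit Types (d : driftCoef R) (c : R).

Definition vec3 (x1 x2 x3 : R) : 'cV[R]_3 := \col_i nth 0 [:: x1; x2; x3] i.

Definition slower3 (x21 x31 x32 : R) : 'M[R]_3 :=
  \matrix_(i, j)
    nth 0 (nth [::] [:: [:: 0; 0; 0]; [:: x21; 0; 0]; [:: x31; x32; 0]] i) j.

Definition e3 : 'cV[R]_3 := const_mx 1.

Definition sqr_cw (v : 'cV[R]_3) : 'cV[R]_3 := map_mx (fun x => x ^+ 2) v.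

Definition D1 d : Prop := ((alpha d)^T *m sqr_cw (A0 d *m e3)) 0 0 = 1 / 3.

Definition D2 d : Prop := ((alpha d)^T *m (A0 d *m (A0 d *m e3))) 0 0 = 1 / 6.

Definition half_cond d : Prop := ((alpha d)^T *m A0 d *m e3) 0 0 = 1 / 2.

Definition case_a d : Prop :=
  [/\ alpha d st2 0 = 3 / 4,
      A0 d st2 st1 = 2 / 3
    & A0 d st3 st1 = - A0 d st3 st2].

Definition case_b d : Prop :=
  [/\ alpha d st3 0 = 3 / 4 - alpha d st2 0,
      A0 d st2 st1 = 2 / 3
    & A0 d st3 st1 = 2 / 3 - A0 d st3 st2].

Definition case_c d : Prop :=
  let a21 := A0 d st2 st1 in
  let a31 := A0 d st3 st1 in
  let a32 := A0 d st3 st2 in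
  [/\ alpha d st2 0 = 1 / 6 * ((2 - 3 * (a31 + a32)) / (a21 * (a21 - a31 - a32))),
      alpha d st3 0 = 1 / 6 * ((3 * a21 - 2) / ((a31 + a32) * (a21 - a31 - a32))),
      a31 + a32 != a21, a21 != 0 & a31 + a32 != 0].

Definition coefA c1 : driftCoef R :=
  DriftCoef (vec3 (1 / 2) (1 / 2) 0) (slower3 1 0 0) (slower3 c1 0 0).

Definition coefBai c1 c6 c7 : driftCoef R :=
  DriftCoef (vec3 (1 / 2 - c6) c6 (1 / 2))
            (slower3 0 c7 (1 - c7)) (slower3 0 c1 0).

Definition coefBaii c1 c6 c7 c8 : driftCoef R :=
  DriftCoef (vec3 (1 / 2 - (1 - c7 - c8) / (2 * c6))
                  ((1 - c7 - c8) / (2 * c6)) (1 / 2))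
            (slower3 c6 c7 c8) (slower3 0 c1 0).

Definition kappa c6 c7 : R := c6 * c7 * (2 * c6 + 2 * c7 - 1).

Definition lambda c6 c7 c8 : R := (1 - 2 * c6 * c8) / (2 * c7).

Definition admBbi c6 c7 : Prop :=
  [/\ c6 != 0 /\ c7 != 0, c6 != - c7, 0 <= kappa c6 c7,
      c6 != Num.sqrt (kappa c6 c7) & c6 != - Num.sqrt (kappa c6 c7)].

(* [s] selects the sign in the pair -+/+-: [false] is the upper choice. *)
Definition coefBbi (s : bool) c1 c6 c7 c8 c9 : driftCoef R :=
  DriftCoef
    (vec3 (1 - c6 - c7) c6 c7)
    (slower3 c8 (lambda c6 c7 c8 - c9) c9)
    (slower3
       (c1 / 2 * ((c6 - (-1) ^+ s * Num.sqrt (kappa c6 c7)) / (c6 * (c6 + c7))))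
       (c1 / 2 * ((c7 + (-1) ^+ s * Num.sqrt (kappa c6 c7)) / (c7 * (c6 + c7))))
       0).

Definition coefBbii c1 c6 c7 c8 : driftCoef R :=
  DriftCoef (vec3 (1 / 2) 0 (1 / 2))
            (slower3 c6 (1 - c7) c7) (slower3 c8 c1 0).

Definition coefBbiii c1 c6 c7 c8 : driftCoef R :=
  DriftCoef (vec3 1 c6 (- c6))
            (slower3 c7 ((1 - 2 * c6 * c7) / (- 2 * c6) - c8) c8)
            (slower3 (c1 / 2 * (1 + 1 / (2 * c6)))
                     (c1 / 2 * (1 - 1 / (2 * c6))) 0).

End Coefficients.

(* Main.v *)
Require Import Defs.
From mathcomp Require Import all_boot all_order all_algebra.
From mathcomp Require Import reals.
From mathcomp Require Import ring lra.

Import Order.TTheory GRing.Theory Num.Theory.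
Local Open Scope ring_scope.

(* With x = a21 and y = a31 + a32 the row sums of A^(0), (D1) is
   al2 x^2 + al3 y^2 = 1/3, (D2) is al3 a32 x = 1/6, and the order two condition
   is al2 x + al3 y = 1/2. The latter and (D1) are linear in (al2, al3) with
   determinant x y (y - x), whence the trichotomy y = 0, y = x, or neither. In
   family (B.b.i), given 0 <= kappa, c6 <> +-sqrt kappa amounts to
   c6 <> c7 (2 c6 + 2 c7 - 1), which in cases a) and c) factors into the excluded
   parameter values and in case b) is linear in c6. *)

Section OrderConditions.
Variable R : realType.
Implicit Types a x y c : R.

(** * The conditions and the three cases in scalar form *)

Lemma D1E a1 a2 a3 x21 x31 x32 (B : 'M[R]_3) :
  D1 (DriftCoef (vec3 a1 a2 a3) (slower3 x21 x31 x32) B) <->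
  a2 * x21 ^+ 2 + a3 * (x31 + x32) ^+ 2 = 1 / 3.
Proof.
rewrite /D1 /= !mxE; do !rewrite !big_ord_recl !big_ord0 /= ?mxE /=.
by split=> <-; ring.
Qed.

Lemma D2E a1 a2 a3 x21 x31 x32 (B : 'M[R]_3) :
  D2 (DriftCoef (vec3 a1 a2 a3) (slower3 x21 x31 x32) B) <->
  a3 * x32 * x21 = 1 / 6.
Proof.
rewrite /D2 /= !mxE; do !rewrite !big_ord_recl !big_ord0 /= ?mxE /=.
by split=> <-; ring.
Qed.

Lemma half_condE a1 a2 a3 x21 x31 x32 (B : 'M[R]_3) :
  half_cond (DriftCoef (vec3 a1 a2 a3) (slower3 x21 x31 x32) B) <->
  a2 * x21 + a3 * (x31 + x32) = 1 / 2.
Proof.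
rewrite /half_cond /= !mxE; do !rewrite !big_ord_recl !big_ord0 /= ?mxE /=.
by split=> <-; ring.
Qed.

Lemma case_aE a1 a2 a3 x21 x31 x32 (B : 'M[R]_3) :
  case_a (DriftCoef (vec3 a1 a2 a3) (slower3 x21 x31 x32) B) <->
  [/\ a2 = 3 / 4, x21 = 2 / 3 & x31 = - x32].
Proof. by rewrite /case_a /= !mxE. Qed.

Lemma case_bE a1 a2 a3 x21 x31 x32 (B : 'M[R]_3) :
  case_b (DriftCoef (vec3 a1 a2 a3) (slower3 x21 x31 x32) B) <->
  [/\ a3 = 3 / 4 - a2, x21 = 2 / 3 & x31 = 2 / 3 - x32].
Proof. by rewrite /case_b /= !mxE. Qed.

Lemma case_cE a1 a2 a3 x21 x31 x32 (B : 'M[R]_3) :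
  case_c (DriftCoef (vec3 a1 a2 a3) (slower3 x21 x31 x32) B) <->
  [/\ a2 = 1 / 6 * ((2 - 3 * (x31 + x32)) / (x21 * (x21 - (x31 + x32)))),
      a3 = 1 / 6 * ((3 * x21 - 2) / ((x31 + x32) * (x21 - (x31 + x32)))),
      x31 + x32 != x21, x21 != 0 & x31 + x32 != 0].
Proof. by rewrite opprD addrA /case_c /= !mxE. Qed.

Lemma half_cond_D1_cases a1 a2 a3 x21 x31 x32 (B : 'M[R]_3) :
  let d := DriftCoef (vec3 a1 a2 a3) (slower3 x21 x31 x32) B in
  half_cond d -> D1 d -> x21 != 0 -> [\/ case_a d, case_b d | case_c d].
Proof.
move=> d /half_condE h /D1E h1 x0.
have [y0|y0] := eqVneq (x31 + x32) 0.
  apply/Or31/case_aE; rewrite y0 in h h1.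
  (* The left side of (D1) is now [x21] times that of the order two condition, so [x21 / 2 = 1 / 3];
     the same holds when [y = x]. *)
  have hx : x21 = 2 / 3 by nra.
  by rewrite hx in h *; split=> //; lra.
have [yx|yx] := eqVneq (x31 + x32) x21.
  apply/Or32/case_bE; rewrite yx in h h1.
  have hx : x21 = 2 / 3 by nra.
  by rewrite hx in h yx *; split=> //; lra.
apply/Or33/case_cE; move: h h1.
move: (x31 + x32) y0 yx => y y0 yx h h1.
have xy0 : x21 - y != 0 by rewrite subr_eq0 eq_sym.
(* Cramer's rule: (D1) minus [y], respectively [x21], times the order two condition. *)
have e2 : a2 * (x21 * (x21 - y)) = (2 - 3 * y) / 6 by nra.
have e3 : a3 * (y * (x21 - y)) = (3 * x21 - 2) / 6 by nra.
split=> //.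
  by apply: (mulIf (mulf_neq0 x0 xy0)); rewrite e2; field; rewrite ?xy0 ?x0.
by apply: (mulIf (mulf_neq0 y0 xy0)); rewrite e3; field; rewrite ?xy0 ?y0.
Qed.

(** In (B.b.i), [lambda] is the row sum a31 + a32, obtained by solving the order two condition,
    which is the second hypothesis. *)
Lemma lambdaE c6 c7 c8 x : c7 != 0 ->
  c6 * c8 + c7 * x = 1 / 2 -> lambda c6 c7 c8 = x.
Proof.
move=> c70 h; rewrite /lambda.
have -> : 1 - 2 * c6 * c8 = 2 * c7 * x by lra.
by field; rewrite c70.
Qed.

(** Squaring c6 = +-sqrt kappa and cancelling one [c6] yields the excluded polynomial relation, so
    no root has to be computed. *)
Lemma admBbi_of_poly c6 c7 :
  c6 != 0 -> c7 != 0 -> c6 + c7 != 0 -> 0 <= kappa c6 c7 ->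
  c6 != c7 * (2 * c6 + 2 * c7 - 1) -> admBbi c6 c7.
Proof.
move=> c60 c70 c67 k0 ck; split=> //.
- by rewrite -addr_eq0.
- apply: contra_neq ck => /(congr1 (fun z => z ^+ 2)).
  rewrite sqr_sqrtr // /kappa expr2 -!mulrA => /(mulfI c60) {1}->; ring.
- apply: contra_neq ck => /(congr1 (fun z => z ^+ 2)).
  rewrite sqrrN sqr_sqrtr // /kappa expr2 -!mulrA => /(mulfI c60) {1}->; ring.
Qed.

(* For the threshold [q = (3 x - 2) / (3 (x - 1))] the last factor of the
   conclusion is [3 (x - 1) (q - y)], and [3 (x - 1) (q - 2/3) = x] decides on which side of 2/3 [q] lies. *)
Lemma kappa_numerator_ge0 x y :
  x \notin [:: 0; 2 / 3] ->
  (x = 1 -> y < 2 / 3) ->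
  (2 / 3 < x < 1 -> (3 * x - 2) / (3 * (x - 1)) <= y < 2 / 3) ->
  (0 < x < 2 / 3 -> 2 / 3 < y \/ y <= (3 * x - 2) / (3 * (x - 1))) ->
  (x < 0 \/ 1 < x -> y < 2 / 3 \/ (3 * x - 2) / (3 * (x - 1)) <= y) ->
  0 <= (2 - 3 * y) * (3 * x - 2) * (3 * x - 2 - 3 * y * (x - 1)).
Proof.
rewrite !inE negb_or => /andP[x0 x23] h1.
have [x1|x1] := eqVneq x 1; first by have := h1 x1; rewrite x1; nra.
have [q qE] : exists q, (3 * x - 2) / (3 * (x - 1)) = q by eexists.
have x10 : x - 1 != 0 by rewrite subr_eq0.
have fE : 3 * x - 2 = 3 * q * (x - 1) by rewrite -qE; field; rewrite x10.
rewrite qE => hmid hlow hext.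
have -> : 3 * x - 2 - 3 * y * (x - 1) = 3 * ((x - 1) * (q - y)) by rewrite fE; ring.
have eq23 : (x - 1) * (3 * q - 2) = x by nra.
(* On each range of [x] the product is regrouped into [(3 * x - 2) * (x - 1)] and
   [(2 - 3 * y) * (q - y)], both with flipped sign when 2/3 < x < 1, so that each is nonnegative. *)
have [xlt0|xgt0|xz] := ltgtP x 0; last by rewrite xz eqxx in x0.
- have q23 : 2 / 3 < q by nra.
  rewrite -mulrA [_ * (3 * _)]mulrC -mulrA.
  have p : 0 <= (3 * x - 2) * (x - 1) by nra.
  have r : 0 <= (2 - 3 * y) * (q - y) by case: hext; [left | nra | nra].
  by have := mulr_ge0 p r; nra.
have [x1lt|x1gt|x1e] := ltgtP x 1; last by rewrite x1e eqxx in x1.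
  have q23 : q < 2 / 3 by nra.
  have [xl|xg|xe] := ltgtP x (2 / 3); last by rewrite xe eqxx in x23.
    have p : 0 <= (3 * x - 2) * (x - 1) by nra.
    have r : 0 <= (2 - 3 * y) * (q - y) by case: hlow; [lra | nra | nra].
    by have := mulr_ge0 p r; nra.
  have p : 0 <= (3 * x - 2) * (1 - x) by nra.
  have r : 0 <= (2 - 3 * y) * (y - q) by have /andP[] := hmid ltac:(lra); nra.
  by have := mulr_ge0 p r; nra.
have q23 : 2 / 3 < q by nra.
have p : 0 <= (3 * x - 2) * (x - 1) by nra.
have r : 0 <= (2 - 3 * y) * (q - y) by case: hext; [right | nra | nra].
by have := mulr_ge0 p r; nra.
Qed.

(* [2 (c6 + c7) - 1 = (3 x - 2 - 3 y (x - 1)) / (3 x y)]. *)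
Lemma admBbi_case_c x y :
  let c6 := 1 / 6 * ((2 - 3 * y) / (x * (x - y))) in
  let c7 := 1 / 6 * ((3 * x - 2) / (y * (x - y))) in
  x != 0 -> x != 2 / 3 -> y != 0 -> y != 2 / 3 -> y != x -> y != 2 / 3 - x ->
  (y - 1) * x != y ^+ 2 - 2 / 3 ->
  0 <= (2 - 3 * y) * (3 * x - 2) * (3 * x - 2 - 3 * y * (x - 1)) ->
  admBbi c6 c7.
Proof.
move=> c6 c7 x0 x23 y0 y23 yx yx23 g0 k0.
have xy0 : x - y != 0 by rewrite subr_eq0 eq_sym.
have n6 : 2 - 3 * y != 0 by apply: contra_neq y23; lra.
have n7 : 3 * x - 2 != 0 by apply: contra_neq x23; lra.
have n67 : 3 * x + 3 * y - 2 != 0 by apply: contra_neq yx23; lra.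
have g : 3 * y ^+ 2 - 3 * x * y + 3 * x - 2 != 0 by apply: contra_neq g0; lra.
have e6 : c6 = (2 - 3 * y) / (6 * x * (x - y)).
  by rewrite /c6; field; rewrite ?x0 ?xy0.
have e7 : c7 = (3 * x - 2) / (6 * y * (x - y)).
  by rewrite /c7; field; rewrite ?y0 ?xy0.
have n6' : (6 : R) != 0 by lra.
apply: admBbi_of_poly.
- by rewrite e6 mulf_neq0 // invr_neq0 // !mulf_neq0.
- by rewrite e7 mulf_neq0 // invr_neq0 // !mulf_neq0.
- have -> : c6 + c7 = (3 * x + 3 * y - 2) / (6 * x * y).
    by rewrite e6 e7; field; rewrite ?x0 ?y0 ?xy0.
  by rewrite mulf_neq0 // invr_neq0 // !mulf_neq0.
(* The denominator is a square, so kappa has the sign of the numerator in the last hypothesis. *)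
- have -> : kappa c6 c7 =
      3 * ((2 - 3 * y) * (3 * x - 2) * (3 * x - 2 - 3 * y * (x - 1)))
        / (18 * x * y * (x - y)) ^+ 2.
    by rewrite /kappa e6 e7; field; rewrite ?x0 ?y0 ?xy0.
  by rewrite mulr_ge0 ?invr_ge0 ?sqr_ge0 // mulr_ge0.
- rewrite -subr_eq0.
  have -> : c6 - c7 * (2 * c6 + 2 * c7 - 1) =
      - ((3 * y ^+ 2 - 3 * x * y + 3 * x - 2) * (3 * x + 3 * y - 2))
        / (18 * x * y ^+ 2 * (x - y)).
    by rewrite e6 e7; field; rewrite ?x0 ?y0 ?xy0.
  have n18 : (18 : R) != 0 by lra.
  by rewrite mulf_neq0 // ?oppr_eq0 ?invr_eq0 ?mulf_neq0 ?expf_neq0.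
Qed.

End OrderConditions.

(* [M] is the type of complete methods, [drift] extracts the coefficients of
   the drift part, and [order m pD pS] says that [m] is of order (pD, pS); the
   only fact used about it is the given criterion for order (3, 2). *)
Theorem mainTheorem4 (R : realType) (M : Type) (drift : M -> driftCoef R)
    (order : M -> nat -> nat -> Prop)
    (order32 : forall m : M,
       order m 2%N 2%N -> D1 (drift m) -> D2 (drift m) -> order m 3%N 2%N) :
  (* 1 *)
  ((forall c1 : R, c1 \in [:: -1; 1] ->
      ~ (D1 (coefA c1) /\ D2 (coefA c1)))
   /\ (forall c1 c6 c7 : R, c1 \in [:: -1; 1] ->
         ~ (D1 (coefBai c1 c6 c7) /\ D2 (coefBai c1 c6 c7)))
   /\ (forall c1 c6 c7 c8 : R, c1 \in [:: -1; 1] -> c8 != 0 ->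
         ~ (D1 (coefBbii c1 c6 c7 c8) /\ D2 (coefBbii c1 c6 c7 c8))))
  /\
  (* 2; [s] selects the sign of the root *)
  (forall (s : bool) (c1 c6 c7 c8 : R), c1 \in [:: -1; 1] -> c6 != 0 ->
     0 <= 9 * c6 ^+ 2 - 36 * c6 + 24 ->
     c7 = 1 / 2 * c6 + (-1) ^+ s * (1 / 6 * Num.sqrt (9 * c6 ^+ 2 - 36 * c6 + 24))
          - 1 / (3 * c6) ->
     c8 = 1 / (3 * c6) ->
     [/\ D1 (coefBaii c1 c6 c7 c8), D2 (coefBaii c1 c6 c7 c8)
       & forall m : M, drift m = coefBaii c1 c6 c7 c8 ->
           order m 2%N 2%N -> order m 3%N 2%N])
  /\
  (* 3; A^(0)_21 <> 0 is implied by (D2) *)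
  ((forall (s : bool) (c1 c6 c7 c8 c9 : R), c1 \in [:: -1; 1] -> admBbi c6 c7 ->
      let d := coefBbi s c1 c6 c7 c8 c9 in
      half_cond d -> D1 d -> A0 d st2 st1 != 0 ->
      [\/ case_a d, case_b d | case_c d])
   /\ (forall c1 c6 c7 c8 : R, c1 \in [:: -1; 1] -> c6 \notin [:: - (1 / 2); 0] ->
         let d := coefBbiii c1 c6 c7 c8 in
         half_cond d -> D1 d -> A0 d st2 st1 != 0 ->
         [\/ case_a d, case_b d | case_c d]))
  /\
  (* 4 *)
  ((forall (s : bool) (c1 c6 c7 c8 c9 : R), c1 \in [:: -1; 1] ->
      c6 = 3 / 4 -> c7 = 1 / (4 * c9) -> c8 = 2 / 3 ->
      c7 \notin [:: - (3 / 4); 0; 1 / 2] -> ~ (- (1 / 4) < c7 < 0) ->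
      let d := coefBbi s c1 c6 c7 c8 c9 in
      [/\ admBbi c6 c7, case_a d, D1 d & D2 d])
   /\ (forall (s : bool) (c1 c6 c7 c8 c9 : R), c1 \in [:: -1; 1] ->
         c6 = 3 / 4 - 1 / (4 * c9) -> c7 = 1 / (4 * c9) -> c8 = 2 / 3 ->
         c9 != 0 -> 0 < c6 < 1 / 4 \/ 1 / 4 < c6 < 3 / 4 ->
         let d := coefBbi s c1 c6 c7 c8 c9 in
         [/\ admBbi c6 c7, case_b d, D1 d & D2 d])
   /\ (forall (s : bool) (c1 c6 c7 c8 c9 lam : R), c1 \in [:: -1; 1] ->
         c6 = 1 / 6 * ((2 - 3 * lam) / (c8 * (c8 - lam))) ->
         c7 = 1 / 6 * ((3 * c8 - 2) / (lam * (c8 - lam))) ->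
         c9 = lam * (c8 - lam) / ((3 * c8 - 2) * c8) ->
         lam \notin [:: 0; 2 / 3; c8; 2 / 3 - c8] ->
         (lam - 1) * c8 != lam ^+ 2 - 2 / 3 ->
         c8 \notin [:: 0; 2 / 3] ->
         (c8 = 1 -> lam < 2 / 3) ->
         (2 / 3 < c8 < 1 -> (3 * c8 - 2) / (3 * (c8 - 1)) <= lam < 2 / 3) ->
         (0 < c8 < 2 / 3 ->
            2 / 3 < lam \/ lam <= (3 * c8 - 2) / (3 * (c8 - 1))) ->
         (c8 < 0 \/ 1 < c8 ->
            lam < 2 / 3 \/ (3 * c8 - 2) / (3 * (c8 - 1)) <= lam) ->
         let d := coefBbi s c1 c6 c7 c8 c9 in
         lam = lambda c6 c7 c8 /\ [/\ admBbi c6 c7, case_c d, D1 d & D2 d]))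
  /\
  (* 5; the remaining parameter c8 is fixed by (D2) *)
  ((forall c1 c6 c7 : R, c1 \in [:: -1; 1] -> c6 = 3 / 4 -> c7 = 2 / 3 ->
      exists c8 : R, let d := coefBbiii c1 c6 c7 c8 in
        [/\ case_a d, D1 d & D2 d])
   /\ (forall c1 c6 c7 : R, c1 \in [:: -1; 1] ->
         c6 = 1 / (4 * c7 - 4 / 3) -> c7 \notin [:: - (1 / 6); 0; 1 / 3] ->
         c6 \notin [:: - (1 / 2); 0] /\
         exists c8 : R, let d := coefBbiii c1 c6 c7 c8 in
           [/\ D1 d, D2 d & c7 != 2 / 3 -> case_c d])
   /\ (forall c1 c6 c7 c8 : R, c1 \in [:: -1; 1] -> c6 \notin [:: - (1 / 2); 0] ->
         let d := coefBbiii c1 c6 c7 c8 in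
         ~ [/\ case_b d, D1 d & D2 d])).
Proof.

(* Families (A), (B.a.i), (B.b.ii) *)
split.
  (* The left side of (D1) is 1/2 in (A) and (B.b.ii); that of (D2) is 0 in (B.a.i). *)
  split; first by move=> c1 _ [/D1E]; lra.
  split; first by move=> c1 c6 c7 _ [_ /D2E]; lra.
  by move=> c1 c6 c7 c8 _ _ [/D1E]; lra.

(* Family (B.a.ii) *)
split.
  move=> s c1 c6 c7 c8 _ c60 disc0 e7 e8.
  have d1 : D1 (coefBaii c1 c6 c7 c8).
    apply/D1E.
    (* For S = c7 + c8, (D1) is the quadratic S^2 - c6 S + c6 - 2/3 = 0, with roots c6/2 + r/6,
       where [r] is the signed square root. *)
    have [r [rE r2]] : exists r, c7 + c8 = c6 / 2 + r / 6 /\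
        r ^+ 2 = 9 * c6 ^+ 2 - 36 * c6 + 24.
      exists ((-1) ^+ s * Num.sqrt (9 * c6 ^+ 2 - 36 * c6 + 24)).
      by rewrite exprMn sqr_sqrtr // sqrr_sign e7 e8; split; ring.
    rewrite (_ : (1 - c7 - c8) / (2 * c6) * c6 ^+ 2 = (1 - (c7 + c8)) / 2 * c6).
      by rewrite rE; lra.
    by field; rewrite c60.
  have d2 : D2 (coefBaii c1 c6 c7 c8) by apply/D2E; rewrite e8; field; rewrite c60.
  split=> // m dm om.
  by apply: order32 om _ _; rewrite dm.

(* The trichotomy for (B.b.i) and (B.b.iii) *)
split.
  split=> [s c1 c6 c7 c8 c9 _ _ d|c1 c6 c7 c8 _ _ d] h d1 x0;
    apply: half_cond_D1_cases h d1 _; by rewrite /= !mxE in x0.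

(* Family (B.b.i), cases a), b), c) *)
split.
  split.
    move=> s c1 c6 c7 c8 c9 _ e6 e7 e8.
    rewrite !inE !negb_or => /and3P[n34 n70 n12] nint d.
    have c90 : c9 != 0 by apply: contra_neq n70; rewrite e7 => ->; rewrite mulr0 invr0 mulr0.
    have c79 : c7 * c9 = 1 / 4 by rewrite e7; field; rewrite c90.
    have l0 : lambda c6 c7 c8 = 0 by apply: lambdaE; rewrite // e6 e8; lra.
    split.
    - rewrite e6; apply: admBbi_of_poly => //.
      + by lra.
      + by apply: contra_neq n34; lra.
      (* Here kappa = 3/4 c7 (2 c7 + 1/2), negative exactly on ]-1/4, 0[. *)
      + rewrite /kappa; have [c7neg|c7pos] := ltP c7 0; last by nra.
        have c7le : c7 <= - (1 / 4) by rewrite leNgt; apply/negP => ?; apply: nint; lra.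
        by nra.
      + rewrite -subr_eq0 (_ : _ - _ = - 2 * ((c7 - 1 / 2) * (c7 + 3 / 4))); last by lra.
        rewrite mulf_neq0 // ?mulf_neq0 ?subr_eq0 ?addr_eq0 //; lra.
    - by apply/case_aE; rewrite l0 sub0r.
    - by apply/D1E; rewrite l0 e6 e8; lra.
    - by apply/D2E; rewrite c79 e8; lra.
  split.
    move=> s c1 c6 c7 c8 c9 _ e6 e7 e8 c90 int6 d.
    have c67 : c7 = 3 / 4 - c6 by rewrite e6 e7; ring.
    have c79 : c7 * c9 = 1 / 4 by rewrite e7; field; rewrite c90.
    have c6gt : 0 < c6 by lra.
    have c7gt : 0 < c7 by lra.
    have l23 : lambda c6 c7 c8 = 2 / 3 by apply: lambdaE; rewrite ?gt_eqF // c67 e8; lra.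
    split.
    - apply: admBbi_of_poly; [exact: lt0r_neq0 | exact: lt0r_neq0 | | |].
      + by apply: lt0r_neq0; rewrite addr_gt0.
      (* As c6 + c7 = 3/4, the last factor of kappa is 1/2, and the excluded relation c6 = c7/2
         means c6 = 1/4. *)
      + by rewrite /kappa !mulr_ge0 ?ltW //; lra.
      + by apply/eqP => ck; rewrite c67 in ck; lra.
    - by apply/case_bE; rewrite l23 e8; split=> //; lra.
    - by apply/D1E; rewrite l23 c67 e8; lra.
    - by apply/D2E; rewrite c79 e8; lra.
  move=> s c1 c6 c7 x c9 y _ e6 e7 e9.
  rewrite !inE !negb_or => /and4P[y0 y23 yx yx23] g0 /andP[x0 x23] h1 h2 h3 h4 d.
  have xy0 : x - y != 0 by rewrite subr_eq0 eq_sym.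
  have n7 : 3 * x - 2 != 0 by apply: contra_neq x23; lra.
  have adm : admBbi c6 c7.
    rewrite e6 e7; apply: admBbi_case_c => //.
    by apply: kappa_numerator_ge0; rewrite // !inE negb_or x0.
  have lE : lambda c6 c7 x = y.
    apply: lambdaE; first by case: adm => -[].
    by rewrite e6 e7; field; rewrite ?x0 ?y0 ?xy0.
  split=> //; split=> //.
  - by apply/case_cE; rewrite lE subrK.
  - by apply/D1E; rewrite lE subrK e6 e7; field; rewrite ?x0 ?y0 ?xy0.
  - by apply/D2E; rewrite e7 e9; field; rewrite ?x0 ?y0 ?xy0 ?n7.

(* Family (B.b.iii) *)
split.
  (* The witness solves (D2), here -3/4 * c8 * 2/3 = 1/6. *)
  move=> c1 c6 c7 _ -> ->; exists (- (1 / 3)) => d.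
  by split; [apply/case_aE | apply/D1E | apply/D2E]; try split; lra.
split.
  move=> c1 c6 x _ e6; rewrite !inE !negb_or => /and3P[x16 x0 x13].
  have n6 : 4 * x - 4 / 3 != 0 by apply: contra_neq x13; lra.
  have c6n : c6 * (4 * x - 4 / 3) = 1 by rewrite e6 div1r mulVf.
  have c60 : c6 != 0 by apply/eqP => z; rewrite z in c6n; lra.
  have c612 : c6 != - (1 / 2).
    by apply/eqP => z; rewrite z in c6n; move/eqP: x16; apply; lra.
  split; first by rewrite c60 c612.
  (* Again the solution of (D2), which reads - c6 c8 x = 1/6. *)
  exists (- (1 / (6 * c6 * x))) => d.
  (* The row sum is x - 1/(2 c6) with 1/c6 = 4 x - 4/3; (D1) then becomes c6 (4 x - 4/3) / 3 =
     1/3. *)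
  have yE : (1 - 2 * c6 * x) / (- 2 * c6) = 2 / 3 - x.
    apply: (mulIf c60); rewrite [LHS](_ : _ = - ((1 - 2 * c6 * x) / 2)); first by lra.
    by field; rewrite c60.
  split.
  - by apply/D1E; rewrite yE subrK; lra.
  - by apply/D2E; field; rewrite c60 x0.
  (* At x = 2/3 the row sum vanishes and c6 = 3/4, which is case a). *)
  move=> x23; apply/case_cE; rewrite yE subrK.
  have y0 : 2 / 3 - x != 0 by apply: contra_neq x23; lra.
  have xy0 : x - (2 / 3 - x) != 0 by apply: contra_neq x13; lra.
  split=> //; last by rewrite eq_sym -subr_eq0.
    apply: (mulIf (mulf_neq0 x0 xy0)); rewrite -[RHS]mulrA divfK ?mulf_neq0 //.
    by transitivity (c6 * (4 * x - 4 / 3) * (x / 2)); [lra | rewrite c6n; lra].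
  apply: (mulIf (mulf_neq0 y0 xy0)); rewrite -[RHS]mulrA divfK ?mulf_neq0 //.
  transitivity (- (c6 * (4 * x - 4 / 3) * ((2 / 3 - x) / 2))); first by lra.
  by rewrite c6n; lra.
(* Case b) demands alpha_2 + alpha_3 = 3/4, but this sum is 0 in (B.b.iii). *)
by move=> c1 c6 c7 c8 _ _ d [/case_bE[e _ _] _ _]; lra.
Qed.
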